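(* Let $A\in\mathbb{R}^{m\times n}$, $m\ge n$, have full rank, let $\Omega\in\mathbb{R}^{s\times m}$ be a sketching matrix such that $\Omega A\in\mathbb{R}^{s\times n}$ has full column rank, and let $\Omega A = QR$ be its exact economic QR decomposition. Let $\widehat{Y}=\Omega A+\Delta_s$ be the computed sketch of $A$ in a precision with unit roundoff $u_s$, where $\Delta_s$ accounts for the errors in casting $A$ to precision $u_s$ and in computing the sketch. Let $\widehat{R}\in\mathbb{R}^{n\times n}$ be the computed $R$-factor of the economic Householder QR decomposition of $\widehat{Y}$ carried out in a precision with unit roundoff $u_{QR}$. Suppose $\Omega$, $u_s$ and $u_{QR}$ are such that $$(2\log_2 n+4)\,n^{1/2}\,\widetilde{\gamma}^{(QR)}_{sn}\,\kappa_2(\widehat{Y})<1 \quad\text{and}\quad (2\log_2 n+4)\,n^{1/2}\,\Vert(\Omega A)^{\dagger}\Vert_2\,\Vert\Delta_s\Vert_2<1,$$ and denote $$\beta=\Bigl(1+18(2\log_2 n+4)\,n^{1/2}\,\widetilde{\gamma}^{(QR)}_{sn}\,\kappa_2(\Omega A)\Bigr)\Bigl(1+2(2\log_2 n+4)\,n^{1/2}\,\Vert(\Omega A)^{\dagger}\Vert_2\,\Vert\Delta_s\Vert_2\Bigr).$$ Then $$\Vert\widehat{R}\Vert_2\le\beta\Vert\Omega A\Vert_2,\qquad \Vert\widehat{R}^{-1}\Vert_2\le\beta\Vert(\Omega A)^{\dagger}\Vert_2,\qquad \kappa_2(\widehat{R})\le\beta^2\kappa_2(\Omega A),$$ $$\Vert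 A\widehat{R}^{-1}\Vert_2\le\beta\Vert AR^{-1}\Vert_2,\qquad \Vert(A\widehat{R}^{-1})^{\dagger}\Vert_2\le\beta\Vert(AR^{-1})^{\dagger}\Vert_2,\qquad \kappa_2(A\widehat{R}^{-1})\le\beta^2\kappa_2(AR^{-1}).$$
   Context: The algorithm considered (randomized sketching-based approximation of the $R$-factor) has two steps: (1) compute the sketch $Y=\Omega A$ in a precision with unit roundoff $u_s$ ($A$ is stored in precision $u_s$); (2) compute an economic Householder QR decomposition $Y=QR$ in a precision with unit roundoff $u_{QR}$ and output the $R$-factor. Hats denote computed quantities: $\widehat{Y}$ is the result of step 1 and $\widehat{R}$ is the $R$-factor returned by step 2 applied to $\widehat{Y}$. The standard model of floating point arithmetic is used, and no overflow or underflow occurs. Notation: $\widetilde{\gamma}^{(QR)}_{k}=\dfrac{c\,k\,u_{QR}}{1-c\,k\,u_{QR}}$, where $c$ is a small constant independent of $k$ (the constant of the standard backward error bound for Householder QR), so that $\widetilde{\gamma}^{(QR)}_{sn}$ is this quantity with $k=sn$ (with $c\,s\,n\,u_{QR}<1$). $B^{\dagger}$ is the Moore-Penrose pseudoinverse and $\kappa_2(B)=\Vert B\Vert_2\Vert B^{\dagger}\Vert_2$. An economic QR decomposition $B=QR$ of an $s\times n$ matrix has $Q\in\mathbb{R}^{s\times n}$ with orthonormal columns and $R\in\mathbb{R}^{n\times n}$ upper triangular. *)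

(* Defs.v *)
From HB Require Import structures.
From mathcomp Require Import all_boot all_order all_algebra.
From mathcomp Require Import all_classical all_reals all_analysis.

Set Implicit Arguments.
Unset Strict Implicit.
Unset Printing Implicit Defensive.

Import Order.TTheory GRing.Theory Num.Theory.

Local Open Scope classical_set_scope.
Local Open Scope ring_scope.

Section Norms.
Variable R : realType.

Definition log2 (x : R) : R := ln x / ln 2.

Definition vnorm2 n (x : 'cV[R]_n) : R := Num.sqrt (\sum_i x i 0 ^+ 2).

(* The set contains 0 (take x = 0) and is bounded, so this sup is a true
   supremum, also when m = 0 or n = 0. *)
Definition mxnorm2 m n (B : 'M[R]_(m, n)) : R :=
  sup [set vnorm2 (B *m x) | x in [set x : 'cV[R]_n | vnorm2 x <= 1]].

Definition is_mp_inv m n (B : 'M[R]_(m, n)) (X : 'M[R]_(n, m)) : Prop :=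
  [/\ B *m X *m B = B, X *m B *m X = X,
      (B *m X)^T = B *m X & (X *m B)^T = X *m B].

(* Moore-Penrose pseudoinverse; mathcomp's [pinvmx] is a different object.
   [mp_invP] and [is_mp_inv_uniq] below show that the choice is never vacuous and
   never ambiguous. *)
Definition mp_inv m n (B : 'M[R]_(m, n)) : 'M[R]_(n, m) := xget 0 (is_mp_inv B).

Definition kappa2 m n (B : 'M[R]_(m, n)) : R := mxnorm2 B * mxnorm2 (mp_inv B).

Lemma mulmx_tr_eq0 m n (B : 'M[R]_(m, n)) : B *m B^T = 0 -> B = 0.
Proof.
move=> BB0; apply/matrixP => i j; rewrite mxE.
have /(congr1 (fun M : 'M[R]_m => M i i)) := BB0.
rewrite !mxE => /eqP; rewrite psumr_eq0; last first.
  by move=> k _; rewrite mxE -expr2 sqr_ge0.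
by move=> /allP /(_ j (mem_index_enum _)); rewrite mxE -expr2 sqrf_eq0 => /eqP.
Qed.

Lemma gram_unit m n (B : 'M[R]_(m, n)) : row_free B -> B *m B^T \in unitmx.
Proof.
move=> freeB; rewrite -row_free_unit; apply/inj_row_free => v vBB0.
have vB0 : v *m B = 0.
  by apply: mulmx_tr_eq0; rewrite trmx_mul mulmxA -(mulmxA v) vBB0 mul0mx.
by apply: (row_free_inj freeB); rewrite /= vB0 mul0mx.
Qed.

Lemma is_mp_inv_mul m n r (C : 'M[R]_(m, r)) (D : 'M[R]_(r, n)) :
    C^T *m C \in unitmx -> D *m D^T \in unitmx ->
  is_mp_inv (C *m D)
    (D^T *m invmx (D *m D^T) *m (invmx (C^T *m C) *m C^T)).
Proof.
move=> CU DU; set U := invmx (D *m D^T); set V := invmx (C^T *m C).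
have BX : C *m D *m (D^T *m U *m (V *m C^T)) = C *m V *m C^T.
  rewrite !mulmxA -(mulmxA C D) -(mulmxA C (D *m D^T)) mulmxV //.
  by rewrite mulmx1.
have XB : D^T *m U *m (V *m C^T) *m (C *m D) = D^T *m U *m D.
  rewrite -!mulmxA (mulmxA C^T) (mulmxA V) mulVmx //.
  by rewrite mul1mx.
split.
- by rewrite BX -!mulmxA (mulmxA C^T) (mulmxA V) mulVmx // mul1mx.
- by rewrite XB -!mulmxA (mulmxA D) (mulmxA U (_ *m _)) mulVmx // mul1mx.
- by rewrite BX !trmx_mul trmxK trmx_inv trmx_mul trmxK mulmxA.
- by rewrite XB !trmx_mul trmxK trmx_inv trmx_mul trmxK mulmxA.
Qed.

Lemma mp_inv_exists m n (B : 'M[R]_(m, n)) : exists X, is_mp_inv B X.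
Proof.
have DU : row_base B *m (row_base B)^T \in unitmx.
  exact/gram_unit/row_base_free.
have CU : (col_base B)^T *m col_base B \in unitmx.
  rewrite -{2}[col_base B]trmxK; apply: gram_unit.
  by rewrite -row_leq_rank mxrank_tr; have /eqP -> := col_base_full B.
by have := is_mp_inv_mul CU DU; rewrite mulmx_base; eexists; eassumption.
Qed.

Lemma mp_invP m n (B : 'M[R]_(m, n)) : is_mp_inv B (mp_inv B).
Proof. exact: xgetPex (mp_inv_exists B). Qed.

Lemma is_mp_inv_uniq m n (B : 'M[R]_(m, n)) X Z :
  is_mp_inv B X -> is_mp_inv B Z -> X = Z.
Proof.
move=> [BXB XBX BXt XBt] [BZB ZBZ BZt ZBt].
have e1 : B *m X = B *m Z.
  by rewrite -{1}BZB -mulmxA -BZt -BXt -trmx_mul mulmxA BXB BZt.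
have e2 : X *m B = Z *m B.
  rewrite -{1}BZB -(mulmxA B) mulmxA -{1}XBt -ZBt -trmx_mul -(mulmxA Z).
  by rewrite (mulmxA B) BXB.
by rewrite -XBX -mulmxA e1 mulmxA e2 ZBZ.
Qed.

(* No sign convention on the diagonal of [Rf]. *)
Definition is_thinQR s n (B : 'M[R]_(s, n)) (Q : 'M[R]_(s, n)) (Rf : 'M[R]_n) :
    Prop :=
  [/\ B = Q *m Rf, Q^T *m Q = 1%:M & is_trig_mx Rf^T].

End Norms.

Section FloatingPoint.
Variable R : realType.

(* [sum_eval add l x]: x is a value of the sum of the list l computed with
   [add], for some ordering and some bracketing of the terms; a list of k > 0
   terms costs exactly k - 1 additions. *)
Inductive sum_eval (add : R -> R -> R) : seq R -> R -> Prop :=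
| sum_eval_nil : sum_eval add [::] 0
| sum_eval_one x : sum_eval add [:: x] x
| sum_eval_add l1 l2 x1 x2 :
    l1 != [::] -> l2 != [::] ->
    sum_eval add l1 x1 -> sum_eval add l2 x2 ->
    sum_eval add (l1 ++ l2) (add x1 x2)
| sum_eval_perm l1 l2 x :
    perm_eq l1 l2 -> sum_eval add l1 x -> sum_eval add l2 x.

(* Standard model with unit roundoff u, without underflow or overflow. The
   field [fl_sum] leaves the summation order free. *)
Record fl_arith (u : R) := FlArith {
  fl_add : R -> R -> R;
  fl_sub : R -> R -> R;
  fl_mul : R -> R -> R;
  fl_div : R -> R -> R;
  fl_sqrt : R -> R;
  fl_sum : seq R -> R;
  fl_addP : forall x y,
    exists2 d, `|d| <= u & fl_add x y = (x + y) * (1 + d);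
  fl_subP : forall x y,
    exists2 d, `|d| <= u & fl_sub x y = (x - y) * (1 + d);
  fl_mulP : forall x y,
    exists2 d, `|d| <= u & fl_mul x y = (x * y) * (1 + d);
  fl_divP : forall x y, y != 0 ->
    exists2 d, `|d| <= u & fl_div x y = (x / y) * (1 + d);
  fl_sqrtP : forall x, 0 <= x ->
    exists2 d, `|d| <= u & fl_sqrt x = Num.sqrt x * (1 + d);
  fl_sumP : forall l, sum_eval fl_add l (fl_sum l)
}.

Section Householder.
Variables (u : R) (fl : fl_arith u).

Definition fl_dot m (x y : 'cV[R]_m) : R :=
  fl_sum fl [seq fl_mul fl (x i 0) (y i 0) | i <- enum 'I_m].

(* For x <> 0, [house_sigma x] is sign(x_1) ||x||_2 with sign(0) = 1, and
   the reflector is I - b v v^T with v = x + sigma e_1, b = 1 / (sigma v_1);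
   it maps x to - sigma e_1. *)
Definition house_sigma m (x : 'cV[R]_m.+1) : R :=
  let r := fl_sqrt fl (fl_dot x x) in if 0 <= x 0 0 then r else - r.

Definition house_v m (x : 'cV[R]_m.+1) : 'cV[R]_m.+1 :=
  \col_i if i == 0 then fl_add fl (x 0 0) (house_sigma x) else x i 0.

Definition house_b m (x : 'cV[R]_m.+1) : R :=
  fl_div fl 1 (fl_mul fl (house_sigma x) (house_v x 0 0)).

(* C - v (b (v^T C)), evaluated in this order. *)
Definition house_apply m p (b : R) (v : 'cV[R]_m) (C : 'M[R]_(m, p)) :
    'M[R]_(m, p) :=
  \matrix_(i, j)
    fl_sub fl (C i j) (fl_mul fl (v i 0) (fl_mul fl b (fl_dot v (col j C)))).

(* R-factor of the economic Householder QR decomposition of an s x n matrix,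
   s >= n (for s < n the missing rows are filled with zeros). As usual the
   entries annihilated in the pivot column are set to zero and not computed;
   a zero pivot column needs no reflection. *)
Fixpoint house_qr_R (s n : nat) : 'M[R]_(s, n) -> 'M[R]_n :=
  match s, n return 'M[R]_(s, n) -> 'M[R]_n with
  | s'.+1, n'.+1 => fun Y : 'M[R]_(1 + s', 1 + n') =>
      let x : 'cV[R]_(1 + s') := lsubmx Y in
      let C : 'M[R]_(1 + s', n') := rsubmx Y in
      let C' := if x == 0 then C else house_apply (house_b x) (house_v x) C in
      let r11 := if x == 0 then 0 else - house_sigma x in
      block_mx (r11%:M : 'M[R]_1) (usubmx C') 0 (house_qr_R (dsubmx C'))
  | _, _ => fun _ => 0
  end.

End Householder.

Definition gamma_tilde (c : R) (k : nat) (u : R) : R :=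
  c * k%:R * u / (1 - c * k%:R * u).

(* c is a constant for which the standard columnwise backward error bound of
   Householder QR holds, uniformly in the dimensions, the unit roundoff, the
   arithmetic and the input matrix (N. J. Higham, Accuracy and Stability of
   Numerical Algorithms, 2nd ed., Theorem 19.4). *)
Definition house_qr_constant (c : R) : Prop :=
  0 < c /\
  forall (s n : nat) (u : R) (fl : fl_arith u) (Y : 'M[R]_(s, n)),
    (n <= s)%N -> c * (s * n)%:R * u < 1 ->
    exists (Q dY : 'M[R]_(s, n)),
      is_thinQR (Y + dY) Q (house_qr_R fl Y) /\
      forall j, vnorm2 (col j dY) <= gamma_tilde c (s * n) u * vnorm2 (col j Y).

End FloatingPoint.

(* Main.v *)
Require Import Defs.
From HB Require Import structures.
From mathcomp Require Import all_boot all_order all_algebra.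
From mathcomp Require Import all_classical all_reals all_analysis.
From mathcomp Require Import ring lra.

Import Order.TTheory GRing.Theory Num.Theory.
Local Open Scope ring_scope.

(** An R-factor enters the six bounds only through the norms [|R x|]: if
    [Y = Q R] with orthonormal columns in [Q], then [|R x| = |Y x|] for every
    [x]. By backward stability the computed factor is an exact R-factor of
    [Y + Ds + dY], where [Y] is the exact sketch, [Ds] the sketching error and
    [dY] the error of the Householder factorization. So everything reduces to
    comparing [|(Y + Ds + dY) x|] with [|Y x|], which is done in two steps.

    First, [|x| <= |Y^+| |Y x|], hence [|Ds x| <= a |Y x|] with
    [a = |Y^+| |Ds| < 1/4]; the norms of the exact and of the computed sketch
    along [x] differ by a factor in [[1 - a, 1 + a]], and
    [kappa(Y + Ds) <= (1 + a) / (1 - a) * kappa(Y)]. Secondly, a columnwise bound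
    [g] on [dY] relative to [Y + Ds] is a normwise bound [sqrt n * g], and the
    same argument gives [|dY x| <= b |(Y + Ds) x|] with
    [b = sqrt n * g * kappa(Y + Ds) < 1/4]. As [beta] dominates both
    [(1 + a)(1 + b)] and the inverse of [(1 - a)(1 - b)]
    ([condition_factor_bounds]), the norms [|Rhat x|] and [|Y x|] are within a
    factor [beta] of each other, in both directions ([sketched_R_equiv]).

    The bounds on [Rhat] and its inverse follow at once. For the preconditioned
    matrix, [A Rhat^-1 = (A R^-1) (R Rhat^-1)], and the equivalence of norms says
    exactly that [R Rhat^-1] and its inverse have norm at most [beta]. Norms of
    pseudoinverses are handled by a dual description ([le_vnorm2_mp_inv] and
    [mxnorm2_mp_inv_le]): for a [B] of full column rank, [|B^+|] is the least
    [k >= 0] such that [|x| <= k |B x|] for all [x]. *)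

(** * Euclidean norm *)

Section EuclideanNorm.
Local Set Implicit Arguments.
Local Unset Strict Implicit.
Variable R : realType.

Lemma cauchy_schwarz_sum (I : finType) (x y : I -> R) :
  (\sum_i x i * y i) ^+ 2 <= (\sum_i x i ^+ 2) * (\sum_i y i ^+ 2).
Proof.
set S := \sum_i x i * y i; set X := \sum_i x i ^+ 2; set Y := \sum_i y i ^+ 2.
have Y0 : 0 <= Y by apply: sumr_ge0 => i _; exact: sqr_ge0.
have [Yp|Yn] := ltP 0 Y; last first.
  have /eqP : Y = 0 by apply/le_anti; rewrite Yn Y0.
  rewrite psumr_eq0; last by move=> i _; exact: sqr_ge0.
  move=> /allP y0.
  have -> : S = 0.
    rewrite /S big1 // => i _.
    have := y0 i (mem_index_enum _).
    by rewrite sqrf_eq0 => /eqP ->; rewrite mulr0.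
  rewrite expr0n /=; apply: mulr_ge0 => //.
  by apply: sumr_ge0 => i _; exact: sqr_ge0.
(* the squared length of Y x - S y is Y (X Y - S ^ 2) *)
have : 0 <= \sum_i (Y * x i - S * y i) ^+ 2.
  by apply: sumr_ge0 => i _; exact: sqr_ge0.
have -> : \sum_i (Y * x i - S * y i) ^+ 2 = Y * (X * Y - S ^+ 2).
  under eq_bigr => i _.
    have -> : (Y * x i - S * y i) ^+ 2 =
      Y ^+ 2 * x i ^+ 2 + (- (2 * Y * S)) * (x i * y i) + S ^+ 2 * y i ^+ 2.
      by ring.
    over.
  rewrite !big_split /= -!mulr_sumr -/X -/Y -/S; ring.
by rewrite pmulr_rge0 // subr_ge0.
Qed.

Lemma vnorm2_ge0 n (x : 'cV[R]_n) : 0 <= vnorm2 x.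
Proof. exact: sqrtr_ge0. Qed.

Lemma sqr_vnorm2 n (x : 'cV[R]_n) : vnorm2 x ^+ 2 = \sum_i x i 0 ^+ 2.
Proof. by rewrite sqr_sqrtr //; apply: sumr_ge0 => i _; exact: sqr_ge0. Qed.

Lemma vnorm2_trmulE n (x : 'cV[R]_n) : vnorm2 x = Num.sqrt ((x^T *m x) 0 0).
Proof.
by rewrite /vnorm2 mxE; congr Num.sqrt; apply: eq_bigr => i _; rewrite mxE expr2.
Qed.

Lemma vnorm2_eq0 n (x : 'cV[R]_n) : vnorm2 x = 0 -> x = 0.
Proof.
move=> x0; apply/colP => i; rewrite mxE.
have /eqP := sqr_vnorm2 x; rewrite x0 expr0n /= eq_sym psumr_eq0; last first.
  by move=> j _; exact: sqr_ge0.
by move=> /allP /(_ i (mem_index_enum _)); rewrite sqrf_eq0 => /eqP.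
Qed.

Lemma vnorm2_0 n : vnorm2 (0 : 'cV[R]_n) = 0.
Proof. by rewrite vnorm2_trmulE mulmx0 mxE sqrtr0. Qed.

Lemma vnorm2Z n k (x : 'cV[R]_n) : vnorm2 (k *: x) = `|k| * vnorm2 x.
Proof.
rewrite /vnorm2 -sqrtr_sqr -sqrtrM ?sqr_ge0 //; congr Num.sqrt.
by rewrite mulr_sumr; apply: eq_bigr => i _; rewrite mxE exprMn.
Qed.

Lemma vnorm2N n (x : 'cV[R]_n) : vnorm2 (- x) = vnorm2 x.
Proof. by rewrite -scaleN1r vnorm2Z normrN1 mul1r. Qed.

Lemma cauchy_schwarz n (x y : 'cV[R]_n) :
  \sum_i x i 0 * y i 0 <= vnorm2 x * vnorm2 y.
Proof.
apply: le_trans (ler_norm _) _.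
rewrite -(@ler_pXn2r _ 2) ?nnegrE ?normr_ge0 ?mulr_ge0 ?vnorm2_ge0 //.
by rewrite real_normK ?num_real // exprMn !sqr_vnorm2; exact: cauchy_schwarz_sum.
Qed.

Lemma vnorm2D n (x y : 'cV[R]_n) : vnorm2 (x + y) <= vnorm2 x + vnorm2 y.
Proof.
rewrite -(@ler_pXn2r _ 2) ?nnegrE ?addr_ge0 ?vnorm2_ge0 //.
rewrite sqrrD !sqr_vnorm2.
have -> : \sum_i (x + y) i 0 ^+ 2 =
  \sum_i x i 0 ^+ 2 + (\sum_i x i 0 * y i 0) *+ 2 + \sum_i y i 0 ^+ 2.
  rewrite -sumrMnl -!big_split /=.
  by apply: eq_bigr => i _; rewrite mxE sqrrD.
by rewrite lerD2r lerD2l lerMn2r cauchy_schwarz orbT.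
Qed.

Lemma vnorm2_sum n (I : finType) (F : I -> 'cV[R]_n) :
  vnorm2 (\sum_i F i) <= \sum_i vnorm2 (F i).
Proof.
elim/big_ind2: _ => [|u a v b ua vb|//]; first by rewrite vnorm2_0.
by apply: le_trans (vnorm2D _ _) _; exact: lerD.
Qed.

Lemma vnorm2_orthonormal s n (Q : 'M[R]_(s, n)) (x : 'cV[R]_n) :
  Q^T *m Q = 1%:M -> vnorm2 (Q *m x) = vnorm2 x.
Proof.
by move=> QQ; rewrite !vnorm2_trmulE trmx_mul -mulmxA (mulmxA Q^T) QQ mul1mx.
Qed.

(** For an orthogonal projector, [|P y| ^ 2 = (y, P y) <= |y| |P y|]. *)
Lemma vnorm2_projector n (P : 'M[R]_n) (y : 'cV[R]_n) :
  P^T = P -> P *m P = P -> vnorm2 (P *m y) <= vnorm2 y.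
Proof.
move=> Pt PP.
have [Py0|Pyn] := ltP 0 (vnorm2 (P *m y)); last first.
  exact: le_trans Pyn (vnorm2_ge0 _).
rewrite -(ler_pM2r Py0) -expr2.
apply: le_trans (cauchy_schwarz _ _).
rewrite vnorm2_trmulE sqr_sqrtr; last first.
  by rewrite mxE; apply: sumr_ge0 => i _; rewrite mxE -expr2 sqr_ge0.
rewrite trmx_mul Pt -mulmxA (mulmxA P) PP mxE.
by under eq_bigr do rewrite mxE.
Qed.

Lemma sum_abs_le_vnorm2 n (x : 'cV[R]_n) :
  \sum_i `|x i 0| <= Num.sqrt n%:R * vnorm2 x.
Proof.
have S0 : 0 <= \sum_i `|x i 0| by apply: sumr_ge0 => i _; exact: normr_ge0.
rewrite -(@ler_pXn2r _ 2) ?nnegrE ?mulr_ge0 ?sqrtr_ge0 ?vnorm2_ge0 //.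
rewrite exprMn sqr_sqrtr ?ler0n // sqr_vnorm2.
have := @cauchy_schwarz_sum 'I_n (fun=> 1) (fun i => `|x i 0|).
under eq_bigr do rewrite mul1r.
under [X in _ <= X * _]eq_bigr do rewrite expr1n.
rewrite sumr_const card_ord.
by under [X in _ <= _ * X]eq_bigr do rewrite real_normK ?num_real //.
Qed.

(** The step from columnwise to normwise bounds, which costs a factor [sqrt n]:
    [|B x| <= k * \sum_j |x_j|]. *)
Lemma vnorm2_mul_columns m n (B : 'M[R]_(m, n)) (k : R) (x : 'cV[R]_n) :
  0 <= k -> (forall j, vnorm2 (col j B) <= k) ->
  vnorm2 (B *m x) <= Num.sqrt n%:R * k * vnorm2 x.
Proof.
move=> k0 Bk.
have -> : B *m x = \sum_j x j 0 *: col j B.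
  apply/colP => i; rewrite mxE summxE; apply: eq_bigr => j _.
  by rewrite !mxE mulrC.
apply: le_trans (vnorm2_sum _) _.
apply: (@le_trans _ _ (\sum_j `|x j 0| * k)).
  by apply: ler_sum => j _; rewrite vnorm2Z ler_wpM2l.
by rewrite -mulr_suml mulrAC ler_wpM2r // sum_abs_le_vnorm2.
Qed.

End EuclideanNorm.

(** * Spectral norm and pseudoinverse *)

Section SpectralNorm.
Local Set Implicit Arguments.
Local Unset Strict Implicit.
Variable R : realType.
Local Open Scope classical_set_scope.

(** Without finiteness, the [sup] defining [mxnorm2] would be a junk value. *)
Lemma mxnorm2_has_sup m n (B : 'M[R]_(m, n)) :
  has_sup [set vnorm2 (B *m x) | x in [set x : 'cV[R]_n | vnorm2 x <= 1]].
Proof.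
split; first by exists (vnorm2 (B *m 0)), 0 => //=; rewrite vnorm2_0 ler01.
pose k := \sum_j vnorm2 (col j B).
have k0 : 0 <= k by apply: sumr_ge0 => j _; exact: vnorm2_ge0.
exists (Num.sqrt n%:R * k) => _ [x /= x1 <-].
apply: (@le_trans _ _ (Num.sqrt n%:R * k * vnorm2 x)).
  apply: vnorm2_mul_columns => // j.
  rewrite /k (bigD1 j) //= lerDl; apply: sumr_ge0 => i _; exact: vnorm2_ge0.
by rewrite ler_piMr // mulr_ge0 // sqrtr_ge0.
Qed.

Lemma vnorm2_mulmx_unit_ball m n (B : 'M[R]_(m, n)) (x : 'cV[R]_n) :
  vnorm2 x <= 1 -> vnorm2 (B *m x) <= mxnorm2 B.
Proof. by move=> x1; apply: (sup_ubound (proj2 (mxnorm2_has_sup B))); exists x. Qed.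

Lemma vnorm2_mulmx m n (B : 'M[R]_(m, n)) (x : 'cV[R]_n) :
  vnorm2 (B *m x) <= mxnorm2 B * vnorm2 x.
Proof.
have [x0|] := ltP 0 (vnorm2 x); last first.
  move=> xle; have -> : x = 0.
    by apply: vnorm2_eq0; apply/le_anti; rewrite xle vnorm2_ge0.
  by rewrite mulmx0 !vnorm2_0 mulr0.
have := @vnorm2_mulmx_unit_ball _ _ B ((vnorm2 x)^-1 *: x).
rewrite -scalemxAr !vnorm2Z ger0_norm ?invr_ge0 ?vnorm2_ge0 //.
by rewrite mulVf ?gt_eqF // [X in X <= mxnorm2 B]mulrC ler_pdivrMr //; apply.
Qed.

Lemma mxnorm2_le m n (B : 'M[R]_(m, n)) (k : R) :
  0 <= k -> (forall x, vnorm2 (B *m x) <= k * vnorm2 x) -> mxnorm2 B <= k.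
Proof.
move=> k0 Bk; apply: ge_sup; first exact: (proj1 (mxnorm2_has_sup B)).
by move=> _ [x /= x1 <-]; apply: le_trans (Bk x) _; rewrite ler_piMr.
Qed.

Lemma mxnorm2_ge0 m n (B : 'M[R]_(m, n)) : 0 <= mxnorm2 B.
Proof.
apply: le_trans (vnorm2_ge0 (B *m 0)) _; apply: vnorm2_mulmx_unit_ball.
by rewrite vnorm2_0 ler01.
Qed.

Lemma kappa2_ge0 m n (B : 'M[R]_(m, n)) : 0 <= kappa2 B.
Proof. by rewrite mulr_ge0 // mxnorm2_ge0. Qed.

Lemma col_vnorm2_le m n (B : 'M[R]_(m, n)) j : vnorm2 (col j B) <= mxnorm2 B.
Proof.
rewrite colE; apply: vnorm2_mulmx_unit_ball.
rewrite /vnorm2 (bigD1 j) //= big1 ?mxE ?eqxx /= => [|i /negPf ij].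
  by rewrite expr1n addr0 sqrtr1.
by rewrite mxE ij expr0n.
Qed.

Lemma rank_mulmx_eq0 m n (B : 'M[R]_(m, n)) :
  \rank B = n -> forall x : 'cV[R]_n, B *m x = 0 -> x = 0.
Proof.
move=> rB x Bx0; apply: trmx_inj; rewrite trmx0.
have fB : row_free B^T by rewrite /row_free mxrank_tr rB.
by apply: (row_free_inj fB); rewrite /= mul0mx -trmx_mul Bx0 trmx0.
Qed.

Lemma mulmx_eq0_unitmx n (B : 'M[R]_n) :
  (forall x : 'cV[R]_n, B *m x = 0 -> x = 0) -> B \in unitmx.
Proof.
move=> Binj; rewrite -unitmx_tr -row_free_unit; apply/inj_row_free => v vB.
apply: trmx_inj; rewrite trmx0; apply: Binj.
by apply: trmx_inj; rewrite trmx_mul trmxK vB trmx0.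
Qed.

Lemma mp_inv_unitmx n (B : 'M[R]_n) : B \in unitmx -> mp_inv B = invmx B.
Proof.
move=> uB; apply: (is_mp_inv_uniq (mp_invP B)); split.
- by rewrite mulmxV // mul1mx.
- by rewrite mulVmx // mul1mx.
- by rewrite mulmxV // trmx1.
- by rewrite mulVmx // trmx1.
Qed.

(** [B (x - B^+ B x) = 0], so [B^+] is a left inverse of an injective [B]. *)
Lemma le_vnorm2_mp_inv m n (B : 'M[R]_(m, n)) :
  (forall x : 'cV[R]_n, B *m x = 0 -> x = 0) ->
  forall x, vnorm2 x <= mxnorm2 (mp_inv B) * vnorm2 (B *m x).
Proof.
move=> Binj x; have [BXB _ _ _] := mp_invP B.
suff /eqP : x - mp_inv B *m (B *m x) = 0.
  by rewrite subr_eq0 => /eqP {1}->; exact: vnorm2_mulmx.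
by apply: Binj; rewrite mulmxBr !mulmxA BXB subrr.
Qed.

(** [B B^+] is an orthogonal projector, so [B] maps [B^+ y] to a vector that is
    not longer than [y]. *)
Lemma mxnorm2_mp_inv_le m n (B : 'M[R]_(m, n)) (k : R) :
  0 <= k -> (forall x, vnorm2 x <= k * vnorm2 (B *m x)) ->
  mxnorm2 (mp_inv B) <= k.
Proof.
move=> k0 Bk; apply: mxnorm2_le => // y.
apply: le_trans (Bk _) _; rewrite ler_wpM2l // mulmxA.
have [BXB _ BXt _] := mp_invP B.
by apply: vnorm2_projector => //; rewrite mulmxA BXB.
Qed.

End SpectralNorm.

(** * Relative perturbations *)

Section Perturbation.
Local Set Implicit Arguments.
Local Unset Strict Implicit.
Variable R : realType.

Lemma vnorm2_perturb n (y e : 'cV[R]_n) (a : R) :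
  vnorm2 e <= a * vnorm2 y ->
  vnorm2 (y + e) <= (1 + a) * vnorm2 y /\ (1 - a) * vnorm2 y <= vnorm2 (y + e).
Proof.
move=> ey; have h1 := vnorm2D y e.
have h2 : vnorm2 y <= vnorm2 (y + e) + vnorm2 e.
  by rewrite -{1}(addrK e y) -(vnorm2N e); exact: vnorm2D.
by split; lra.
Qed.

(** If the sketching error is small relative to the smallest singular value, the
    perturbed condition number is controlled; the bound is stated without
    division by [1 - a]. *)
Lemma kappa2_perturb m n (Y D : 'M[R]_(m, n)) (a : R) :
  0 <= a < 1 ->
  (forall x : 'cV[R]_n, Y *m x = 0 -> x = 0) ->
  (forall x : 'cV[R]_n, vnorm2 (D *m x) <= a * vnorm2 (Y *m x)) ->
  (1 - a) * kappa2 (Y + D) <= (1 + a) * kappa2 Y.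
Proof.
move=> /andP[a0 a1] Yinj Da; rewrite /kappa2.
have N0 := mxnorm2_ge0 Y; have P0 := mxnorm2_ge0 (mp_inv Y).
have bnd x := vnorm2_perturb (Da x).
have ub : mxnorm2 (Y + D) <= (1 + a) * mxnorm2 Y.
  apply: mxnorm2_le => [|x]; first by rewrite mulr_ge0 // addr_ge0.
  rewrite mulmxDl; apply: le_trans (proj1 (bnd x)) _.
  by rewrite -mulrA ler_wpM2l ?addr_ge0 // vnorm2_mulmx.
have lb : mxnorm2 (mp_inv (Y + D)) <= (1 - a)^-1 * mxnorm2 (mp_inv Y).
  apply: mxnorm2_mp_inv_le => [|x].
    by rewrite mulr_ge0 // invr_ge0 subr_ge0 ltW.
  rewrite mulrAC mulrC; apply: le_trans (le_vnorm2_mp_inv Yinj x) _.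
  rewrite ler_wpM2l // mulrC ler_pdivlMr ?subr_gt0 // mulrC mulmxDl.
  exact: (proj2 (bnd x)).
have d0 : 0 < 1 - a by rewrite subr_gt0.
rewrite mulrCA mulrA.
have -> : (1 + a) * (mxnorm2 Y * mxnorm2 (mp_inv Y)) =
   ((1 + a) * mxnorm2 Y) * mxnorm2 (mp_inv Y) by rewrite mulrA.
rewrite -mulrA; apply: ler_pM => //; rewrite ?mxnorm2_ge0 //.
  by rewrite mulr_ge0 ?mxnorm2_ge0 // ltW.
by rewrite mulrC -ler_pdivlMr // mulrC.
Qed.

Lemma condition_factor_ge0 (L r g k p d : R) :
  4 <= L -> 0 <= r -> 0 <= g -> 0 <= k -> 0 <= p -> 0 <= d ->
  0 <= (1 + 18 * L * r * g * k) * (1 + 2 * L * r * p * d).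
Proof.
move=> /(le_trans (ler0n R 4)) L0 r0 g0 k0 p0 d0.
by rewrite mulr_ge0 // addr_ge0 // !mulr_ge0.
Qed.

(** The scalar estimate that turns the two perturbation factors into [beta].
    Here [L] and [r] are the logarithmic factor and [sqrt n], [g] is the
    columnwise backward error, [k] and [kh] are the condition numbers of the
    exact and of the computed sketch. The bounds [L >= 4] and [r >= 1]
    make [a] and [b = r g kh] smaller than [1/4], so that
    [1 <= (1 + 8 a) (1 - a)], [b <= 5/3 r g k] and
    [1 <= (1 + 72 r g k) (1 - b)]. *)
Lemma condition_factor_bounds (L r g k kh a : R) :
  4 <= L -> 1 <= r -> 0 <= g -> 0 <= k -> 0 <= kh -> 0 <= a ->
  L * r * g * kh < 1 -> L * r * a < 1 -> (1 - a) * kh <= (1 + a) * k ->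
  let beta := (1 + 18 * L * r * g * k) * (1 + 2 * L * r * a) in
  let b := r * g * kh in
  [/\ b < 1, (1 + a) * (1 + b) <= beta & 1 <= beta * ((1 - a) * (1 - b))].
Proof.
move=> L4 r1 g0 k0 kh0 a0 h1 h2 h3 beta b.
pose t := r * g * k.
have rg0 : 0 <= r * g by rewrite mulr_ge0 // (le_trans ler01).
have b0 : 0 <= b by rewrite mulr_ge0.
have t0 : 0 <= t by rewrite mulr_ge0.
have b4 : 4 * b < 1.
  apply: le_lt_trans h1.
  have -> : L * r * g * kh = L * b by rewrite /b; ring.
  by rewrite ler_wpM2r.
have Lr4 : 4 <= L * r by rewrite -[4]mulr1 ler_pM.
have a4 : 4 * a < 1 by apply: le_lt_trans h2; rewrite ler_wpM2r.
have bt : (1 - a) * b <= (1 + a) * t.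
  by rewrite /b /t mulrCA [leRHS]mulrCA ler_wpM2l.
have bt3 : 3 * b <= 5 * t.
  have : 3 / 4 * b <= (1 - a) * b by apply: ler_wpM2r => //; lra.
  have : (1 + a) * t <= 5 / 4 * t by apply: ler_wpM2r => //; lra.
  lra.
have f1 : 1 + 72 * t <= 1 + 18 * L * r * g * k.
  have -> : 18 * L * r * g * k = 18 * (L * t) by rewrite /t; ring.
  have : 4 * t <= L * t by rewrite ler_wpM2r.
  lra.
have f2 : 1 + 8 * a <= 1 + 2 * L * r * a.
  have -> : 2 * L * r * a = 2 * (L * r * a) by ring.
  have : 4 * a <= L * r * a by rewrite ler_wpM2r.
  lra.
have F : (1 + 72 * t) * (1 + 8 * a) <= beta by apply: ler_pM => //; lra.
split; try lra.
  apply: le_trans F; rewrite mulrC; apply: ler_pM; lra.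
apply: (@le_trans _ _ ((1 + 72 * t) * (1 + 8 * a) * ((1 - a) * (1 - b)))); last first.
  by rewrite ler_wpM2r // mulr_ge0; lra.
rewrite mulrACA [X in _ <= _ * X]mulrC mulrACA.
have g1 : 1 <= (1 + 8 * a) * (1 - a) by nra.
have g2 : 1 <= (1 + 72 * t) * (1 - b) by nra.
nra.
Qed.


(** Applies the perturbation bound twice, first to [D] relative to [Y], then to
    [dY] relative to [Y + D]. Doing so in sequence, instead of once with
    [D + dY], lets the second step use [kappa2 (Y + D)], the quantity that the
    hypothesis on the backward error controls. *)
Lemma sketched_R_equiv s n (Y D dY Q : 'M[R]_(s, n)) (Rh : 'M[R]_n)
    (L g : R) :
  let r := Num.sqrt n%:R in
  let beta := (1 + 18 * L * r * g * kappa2 Y)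
              * (1 + 2 * L * r * mxnorm2 (mp_inv Y) * mxnorm2 D) in
  4 <= L -> 0 <= g -> (forall x : 'cV[R]_n, Y *m x = 0 -> x = 0) ->
  Y + D + dY = Q *m Rh -> Q^T *m Q = 1%:M ->
  (forall j, vnorm2 (col j dY) <= g * vnorm2 (col j (Y + D))) ->
  L * r * g * kappa2 (Y + D) < 1 ->
  L * r * mxnorm2 (mp_inv Y) * mxnorm2 D < 1 ->
  forall x : 'cV[R]_n, vnorm2 (Rh *m x) <= beta * vnorm2 (Y *m x) /\
                       vnorm2 (Y *m x) <= beta * vnorm2 (Rh *m x).
Proof.
move=> r beta L4 g0 Yinj QR QQ dYg h1 h2 x.
case: (posnP n) => [n0|n_gt0].
  (* there is only one vector, and [r >= 1] fails *)
  have -> : x = 0 by apply/colP => i; have := ltn_ord i; rewrite {2}n0.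
  by rewrite !mulmx0 !vnorm2_0 mulr0.
set p := mxnorm2 (mp_inv Y); set d := mxnorm2 D; pose a := p * d.
have p0 : 0 <= p by exact: mxnorm2_ge0.
have d0 : 0 <= d by exact: mxnorm2_ge0.
have r1 : 1 <= r by rewrite -sqrtr1 ler_wsqrtr // ler1n.
have a0 : 0 <= a by rewrite mulr_ge0.
have Lra : L * r * a < 1 by rewrite mulrA.
have a1 : a < 1.
  apply: le_lt_trans Lra; rewrite -{1}[a]mul1r ler_wpM2r // -[1]mulr1.
  by apply: ler_pM => //; lra.
have Da z : vnorm2 (D *m z) <= a * vnorm2 (Y *m z).
  apply: le_trans (vnorm2_mulmx D z) _; rewrite mulrAC [leRHS]mulrC ler_wpM2l //.
  exact: le_vnorm2_mp_inv.
have bndD z := vnorm2_perturb (Da z).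
have kk : (1 - a) * kappa2 (Y + D) <= (1 + a) * kappa2 Y.
  by apply: kappa2_perturb => //; rewrite a0 a1.
have := condition_factor_bounds L4 r1 g0 (kappa2_ge0 Y)
  (kappa2_ge0 (Y + D)) a0 h1 Lra kk.
have -> : 2 * L * r * a = 2 * L * r * p * d by rewrite mulrA.
rewrite -/beta; set b := r * g * kappa2 (Y + D) => /= -[b1 hi lo].
have r0 : 0 <= r := le_trans ler01 r1.
have b0 : 0 <= b := mulr_ge0 (mulr_ge0 r0 g0) (kappa2_ge0 _).
have Yhinj (z : 'cV[R]_n) : (Y + D) *m z = 0 -> z = 0.
  move=> z0; apply: Yinj; apply: vnorm2_eq0; apply/le_anti.
  rewrite vnorm2_ge0 andbT; have := proj2 (bndD z).
  by rewrite -mulmxDl z0 vnorm2_0 pmulr_rle0 // subr_gt0.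
have dYb : vnorm2 (dY *m x) <= b * vnorm2 ((Y + D) *m x).
  apply: (@le_trans _ _ (r * (g * mxnorm2 (Y + D)) * vnorm2 x)).
    apply: vnorm2_mul_columns => [|j]; first by rewrite mulr_ge0 ?mxnorm2_ge0.
    by apply: le_trans (dYg j) _; rewrite ler_wpM2l // col_vnorm2_le.
  have -> : b * vnorm2 ((Y + D) *m x) = r * (g * mxnorm2 (Y + D)) *
      (mxnorm2 (mp_inv (Y + D)) * vnorm2 ((Y + D) *m x)).
    by rewrite /b /kappa2; ring.
  rewrite ler_wpM2l ?le_vnorm2_mp_inv //.
  by rewrite mulr_ge0 // mulr_ge0 // mxnorm2_ge0.
have [up dn] := vnorm2_perturb dYb.
have [upD dnD] := bndD x.
rewrite -mulmxDl in upD dnD.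
rewrite -mulmxDl QR -mulmxA (vnorm2_orthonormal _ QQ) in up dn.
have Y0 := vnorm2_ge0 (Y *m x); have R0 := vnorm2_ge0 (Rh *m x).
have ab0 : 0 <= (1 + a) * (1 + b) by apply: mulr_ge0; lra.
split.
  apply: le_trans up _; apply: (@le_trans _ _ ((1 + b) * ((1 + a) * vnorm2 (Y *m x)))).
    by rewrite ler_wpM2l // addr_ge0.
  by rewrite mulrA ler_wpM2r // mulrC.
have low : (1 - a) * (1 - b) * vnorm2 (Y *m x) <= vnorm2 (Rh *m x).
  apply: le_trans dn; rewrite [_ * (1 - b)]mulrC -mulrA ler_wpM2l //.
  by rewrite subr_ge0 ltW.
apply: le_trans (_ : beta * ((1 - a) * (1 - b) * vnorm2 (Y *m x)) <= _).
  by rewrite mulrA -{1}[vnorm2 (Y *m x)]mul1r ler_wpM2r.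
by rewrite ler_wpM2l // (le_trans ab0).
Qed.

End Perturbation.


(** * Bounds for the computed R-factor *)

Section Bounds.
Variable R : realType.
Local Set Implicit Arguments.
Local Unset Strict Implicit.

Lemma unit_roundoff_ge0 (u : R) : fl_arith u -> 0 <= u.
Proof. by move=> fl; have [d du _] := fl_addP fl 0 0; apply: le_trans du. Qed.

Lemma gamma_tilde_ge0 (c : R) k (u : R) :
  0 <= c -> 0 <= u -> c * k%:R * u < 1 -> 0 <= gamma_tilde c k u.
Proof.
move=> c0 u0 cku; rewrite divr_ge0 ?mulr_ge0 ?ler0n //.
by rewrite subr_ge0 ltW.
Qed.

(** For [n = 0] the logarithm is [0] by convention, so the bound holds there
    too. *)
Lemma log_factor_ge4 n : 4 <= 2 * log2 n%:R + 4 :> R.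
Proof.
rewrite lerDr mulr_ge0 // /log2 divr_ge0 //; last by rewrite ln_ge0 // ler1n.
by case: n => [|n]; [rewrite ln0|rewrite ln_ge0 // ler1n].
Qed.

Lemma kappa2_le m n p q (B : 'M[R]_(m, n)) (C : 'M[R]_(p, q)) (k : R) :
  0 <= k -> mxnorm2 B <= k * mxnorm2 C ->
  mxnorm2 (mp_inv B) <= k * mxnorm2 (mp_inv C) ->
  kappa2 B <= k ^+ 2 * kappa2 C.
Proof.
move=> k0 BC BCi; rewrite /kappa2 expr2 mulrACA.
by apply: ler_pM; rewrite ?mxnorm2_ge0.
Qed.

Lemma R_equiv_norm_bounds s n (Y : 'M[R]_(s, n)) (Rh : 'M[R]_n) (k : R) :
  0 <= k -> (forall x : 'cV[R]_n, Y *m x = 0 -> x = 0) -> Rh \in unitmx ->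
  (forall x : 'cV[R]_n, vnorm2 (Rh *m x) <= k * vnorm2 (Y *m x)) ->
  (forall x : 'cV[R]_n, vnorm2 (Y *m x) <= k * vnorm2 (Rh *m x)) ->
  mxnorm2 Rh <= k * mxnorm2 Y /\
  mxnorm2 (mp_inv Rh) <= k * mxnorm2 (mp_inv Y).
Proof.
move=> k0 Yinj uRh up low; split.
  apply: mxnorm2_le => [|x]; first by rewrite mulr_ge0 ?mxnorm2_ge0.
  by apply: le_trans (up x) _; rewrite -mulrA ler_wpM2l ?vnorm2_mulmx.
apply: mxnorm2_mp_inv_le => [|x]; first by rewrite mulr_ge0 ?mxnorm2_ge0.
apply: le_trans (le_vnorm2_mp_inv Yinj x) _.
by rewrite [k * _]mulrC -mulrA ler_wpM2l ?mxnorm2_ge0.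
Qed.

(** Two invertible factors [Rf] and [Rh] with equivalent norms [|R x|] give
    equivalent right preconditioners: with [B = A Rf^-1] one has
    [A Rh^-1 = B T], where [T = Rf Rh^-1] and its inverse have norm at most
    [k]. *)
Lemma precond_norm_bounds m n (A : 'M[R]_(m, n)) (Rf Rh : 'M[R]_n) (k : R) :
  0 <= k -> (forall x : 'cV[R]_n, A *m x = 0 -> x = 0) ->
  Rf \in unitmx -> Rh \in unitmx ->
  (forall x : 'cV[R]_n, vnorm2 (Rh *m x) <= k * vnorm2 (Rf *m x)) ->
  (forall x : 'cV[R]_n, vnorm2 (Rf *m x) <= k * vnorm2 (Rh *m x)) ->
  mxnorm2 (A *m invmx Rh) <= k * mxnorm2 (A *m invmx Rf) /\
  mxnorm2 (mp_inv (A *m invmx Rh)) <= k * mxnorm2 (mp_inv (A *m invmx Rf)).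
Proof.
move=> k0 Ainj uRf uRh up low.
have AT x : A *m invmx Rh *m x = A *m invmx Rf *m (Rf *m (invmx Rh *m x)).
  by rewrite -!mulmxA (mulmxA _ Rf) mulVmx // mul1mx.
have Rx (x : 'cV[R]_n) : Rh *m (invmx Rh *m x) = x by rewrite mulKVmx.
split.
  apply: mxnorm2_le => [|x]; first by rewrite mulr_ge0 ?mxnorm2_ge0.
  rewrite AT; apply: le_trans (vnorm2_mulmx _ _) _.
  rewrite [k * _]mulrC -mulrA ler_wpM2l ?mxnorm2_ge0 //.
  by rewrite -{2}(Rx x).
have Binj (x : 'cV[R]_n) : A *m invmx Rf *m x = 0 -> x = 0.
  rewrite -mulmxA => /Ainj e.
  by rewrite -[x](mulKVmx uRf) e mulmx0.
apply: mxnorm2_mp_inv_le => [|x]; first by rewrite mulr_ge0 ?mxnorm2_ge0.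
rewrite AT -{1}(Rx x); apply: le_trans (up _) _.
by rewrite -mulrA ler_wpM2l // le_vnorm2_mp_inv.
Qed.

End Bounds.

Theorem theorem3p1 (R : realType) (m n s : nat)
  (A : 'M[R]_(m, n)) (Omega : 'M[R]_(s, m))
  (Q : 'M[R]_(s, n)) (Rf : 'M[R]_n)
  (Delta_s Yhat : 'M[R]_(s, n))
  (c u_QR : R) (fl : fl_arith u_QR) (Rhat : 'M[R]_n) (beta : R)
  (hmn : (n <= m)%N)
  (hA : \rank A = n)
  (hOA : \rank (Omega *m A) = n)
  (hQR : is_thinQR (Omega *m A) Q Rf)
  (hY : Yhat = Omega *m A + Delta_s)
  (hc : house_qr_constant c)
  (hcu : c * (s * n)%:R * u_QR < 1)
  (hR : Rhat = house_qr_R fl Yhat)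
  (h1 : (2 * log2 n%:R + 4) * Num.sqrt n%:R * gamma_tilde c (s * n) u_QR
          * kappa2 Yhat < 1)
  (h2 : (2 * log2 n%:R + 4) * Num.sqrt n%:R * mxnorm2 (mp_inv (Omega *m A))
          * mxnorm2 Delta_s < 1)
  (hbeta : beta =
     (1 + 18 * (2 * log2 n%:R + 4) * Num.sqrt n%:R * gamma_tilde c (s * n) u_QR
            * kappa2 (Omega *m A))
     * (1 + 2 * (2 * log2 n%:R + 4) * Num.sqrt n%:R
            * mxnorm2 (mp_inv (Omega *m A)) * mxnorm2 Delta_s)) :
  [/\ Rhat \in unitmx,
      mxnorm2 Rhat <= beta * mxnorm2 (Omega *m A),
      mxnorm2 (invmx Rhat) <= beta * mxnorm2 (mp_inv (Omega *m A)) &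
      kappa2 Rhat <= beta ^+ 2 * kappa2 (Omega *m A)]
  /\
  [/\ mxnorm2 (A *m invmx Rhat) <= beta * mxnorm2 (A *m invmx Rf),
      mxnorm2 (mp_inv (A *m invmx Rhat)) <= beta * mxnorm2 (mp_inv (A *m invmx Rf)) &
      kappa2 (A *m invmx Rhat) <= beta ^+ 2 * kappa2 (A *m invmx Rf)].

Proof.
have [c_gt0 /(_ s n u_QR fl Yhat)] := hc.
have n_le_s : (n <= s)%N by rewrite -hOA rank_leq_row.
case=> // Qh [dY [[QRh QQh _] dYg]]; rewrite -hR in QRh.
have [QR QQ _] := hQR.
have g0 : 0 <= gamma_tilde c (s * n) u_QR.
  by apply: gamma_tilde_ge0 => //; [exact: ltW|exact: unit_roundoff_ge0 fl].
have L4 := log_factor_ge4 R n.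
have Yinj := rank_mulmx_eq0 hOA.
have Ainj := rank_mulmx_eq0 hA.
rewrite hY in QRh dYg h1.
have equiv := sketched_R_equiv L4 g0 Yinj QRh QQh dYg h1 h2.
rewrite /= -hbeta in equiv.
have beta0 : 0 <= beta.
  rewrite hbeta; apply: condition_factor_ge0 => //;
  by rewrite ?sqrtr_ge0 ?mxnorm2_ge0 ?kappa2_ge0.
have YRf (x : 'cV[R]_n) : vnorm2 (Omega *m A *m x) = vnorm2 (Rf *m x).
  by rewrite QR -mulmxA (vnorm2_orthonormal _ QQ).
have injR (T : 'M[R]_n) (k : R) :
    (forall x : 'cV[R]_n, vnorm2 (Omega *m A *m x) <= k * vnorm2 (T *m x)) ->
    T \in unitmx.
  move=> low; apply: mulmx_eq0_unitmx => x Tx0; apply: Yinj; apply: vnorm2_eq0.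
  by apply/le_anti; rewrite vnorm2_ge0 (le_trans (low x)) // Tx0 vnorm2_0 mulr0.
have up x := proj1 (equiv x); have low x := proj2 (equiv x).
have uRh : Rhat \in unitmx by exact: injR low.
have uRf : Rf \in unitmx by apply: (injR _ 1) => x; rewrite mul1r YRf.
have [R1 R2] := R_equiv_norm_bounds beta0 Yinj uRh up low.
have [P1 P2] : mxnorm2 (A *m invmx Rhat) <= beta * mxnorm2 (A *m invmx Rf) /\
    mxnorm2 (mp_inv (A *m invmx Rhat)) <= beta * mxnorm2 (mp_inv (A *m invmx Rf)).
  by apply: precond_norm_bounds => // x; rewrite -YRf.
split; split => //; try exact: kappa2_le.
by rewrite -mp_inv_unitmx.
Qed.
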